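(* For all integers $n,k \geq 0$, $$|[k+2]^n(123)|= \sum_{r,i\ge 0}2^{n-r}C_i\binom i {r-i} \binom n r \binom k i,$$ where $C_i=\frac1{i+1}\binom{2i}{i}$ is the $i$th Catalan number. The generating function $F(x,y):=\sum_{n,k\ge 0}|[k+2]^n(123)|x^ky^n$ is given by $$F(x,y)= \frac 1 {(1-x)(1-2y)}\, C\!\left( \frac{xy(1-y)}{(1-x)(1-2y)^2} \right),$$ where $C(z)=\sum_{i\ge0}C_iz^i$ is the generating function for the Catalan numbers. Equivalently, $F(x,y)$ is algebraic of degree two and satisfies the equation $$x(1-x)y(1-y)F^2-(1-x)(1-2y)F+1=0.$$
   Context: $[m]=\{1,\dots,m\}$ and $[m]^n$ is the set of words of length $n$ with letters in $[m]$. A word $w=w_1\cdots w_n$ avoids the pattern $123$ if there are no indices $a<b<c$ with $w_a<w_b<w_c$; $[m]^n(123)$ is the set of words in $[m]^n$ avoiding $123$. Binomial coefficients $\binom{a}{b}$ are $0$ unless $0\le b\le a$; terms with a vanishing binomial coefficient are $0$. *)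

(* Defs.v *)
From HB Require Import structures.
From mathcomp Require Import all_boot all_order all_algebra.
From mathcomp Require Import boolp.

Set Implicit Arguments.
Unset Strict Implicit.
Unset Printing Implicit Defensive.

Import GRing.Theory.
Local Open Scope ring_scope.

(* Formal power series R[[X]] over a commutative ring.  Iterating the          *)
(* construction, {fps {fps R}} is R[[y]][[x]] = R[[x, y]], where the outer     *)
(* variable is x and f k n is the coefficient of x^k y^n.                      *)
Record fps (R : Type) := Fps { fps_coef : nat -> R }.

Notation "{ 'fps' R }" := (fps R) (at level 0, format "{ 'fps'  R }")
  : type_scope.
Coercion fps_coef : fps >-> Funclass.

Lemma fpsP (R : Type) (f g : {fps R}) :
  (forall n, f n = g n) -> f = g.
Proof. by case: f g => [f] [g] fg; congr Fps; apply: funext. Qed.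

HB.instance Definition _ (R : Type) := gen_eqMixin {fps R}.
HB.instance Definition _ (R : Type) := gen_choiceMixin {fps R}.

Section FpsZmodule.
Variable R : zmodType.
Implicit Types f g h : {fps R}.

Definition fps_zero : {fps R} := Fps (fun=> 0).
Definition fps_opp f : {fps R} := Fps (fun n => - f n).
Definition fps_add f g : {fps R} := Fps (fun n => f n + g n).

Fact fps_addA : associative fps_add.
Proof. by move=> f g h; apply: fpsP => n; rewrite /= addrA. Qed.
Fact fps_addC : commutative fps_add.
Proof. by move=> f g; apply: fpsP => n; rewrite /= addrC. Qed.
Fact fps_add0 : left_id fps_zero fps_add.
Proof. by move=> f; apply: fpsP => n; rewrite /= add0r. Qed.
Fact fps_addN : left_inverse fps_zero fps_opp fps_add.
Proof. by move=> f; apply: fpsP => n; rewrite /= addNr. Qed.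

HB.instance Definition _ := GRing.isZmodule.Build {fps R}
  fps_addA fps_addC fps_add0 fps_addN.

Lemma fps_coef0 n : (0 : {fps R}) n = 0. Proof. by []. Qed.
Lemma fps_coefN f n : (- f) n = - f n. Proof. by []. Qed.
Lemma fps_coefD f g n : (f + g) n = f n + g n.
Proof. by []. Qed.
Lemma fps_coefB f g n : (f - g) n = f n - g n.
Proof. by []. Qed.
Lemma fps_coef_sum I (r : seq I) (P : pred I) (F : I -> {fps R}) n :
  (\sum_(i <- r | P i) F i) n = \sum_(i <- r | P i) (F i) n.
Proof.
exact: (big_morph (fun f : {fps R} => f n) (fun f g => fps_coefD f g n)).
Qed.
End FpsZmodule.

Section FpsRing.
Variable R : comNzRingType.
Implicit Types f g h : {fps R}.

Definition fpsC (c : R) : {fps R} := Fps (fun n => if n == 0%N then c else 0).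
Definition fpsX : {fps R} := Fps (fun n => (n == 1%N)%:R).
Definition fps_mul f g : {fps R} :=
  Fps (fun n => \sum_(i < n.+1) f i * g (n - i)%N).

Let T N f : {poly R} := \poly_(i < N) f i.

Let coefT N f i : (i < N)%N -> (T N f)`_i = f i.
Proof. by move=> iN; rewrite coef_poly iN. Qed.

Let coefTM N f g i : (i < N)%N -> (T N f * T N g)`_i = (fps_mul f g) i.
Proof.
move=> iN; rewrite coefM; apply: eq_bigr => j _.
have le_ji : (j <= i)%N by rewrite -ltnS.
by rewrite !coefT ?(leq_ltn_trans _ iN) ?leq_subr.
Qed.

Fact fps_mulA : associative fps_mul.
Proof.
move=> f g h; apply: fpsP => n.
have lt_n i : (i <= n)%N -> (i < n.+1)%N by [].
have -> : (fps_mul f (fps_mul g h)) n =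
          (T n.+1 f * (T n.+1 g * T n.+1 h))`_n.
  rewrite coefM; apply: eq_bigr => i _.
  by rewrite coefTM ?coefT // ltnS leq_subr.
have -> : (fps_mul (fps_mul f g) h) n =
          (T n.+1 f * T n.+1 g * T n.+1 h)`_n.
  rewrite coefM; apply: eq_bigr => i _.
  by rewrite coefTM ?coefT // ltnS leq_subr.
by rewrite mulrA.
Qed.

Fact fps_mulC : commutative fps_mul.
Proof.
by move=> f g; apply: fpsP => n; rewrite -!(coefTM _ _ (ltnSn n)) mulrC.
Qed.

Fact fps_mul1 : left_id (fpsC 1) fps_mul.
Proof.
move=> f; apply: fpsP => n /=.
by rewrite big_ord_recl /= subn0 mul1r big1 ?addr0 // => i _; rewrite mul0r.
Qed.

Fact fps_mulDl : left_distributive fps_mul +%R.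
Proof.
move=> f g h; apply: fpsP => n /=.
by rewrite -big_split; apply: eq_bigr => i _; rewrite mulrDl.
Qed.

Fact fps_one_neq0 : fpsC 1 != 0.
Proof.
by apply/eqP => /(congr1 (fun u : {fps R} => u 0%N)) /eqP; rewrite /= oner_eq0.
Qed.

HB.instance Definition _ := GRing.Zmodule_isComNzRing.Build {fps R}
  fps_mulA fps_mulC fps_mul1 fps_mulDl fps_one_neq0.

Lemma fps_coefM f g n :
  (f * g) n = \sum_(i < n.+1) f i * g (n - i)%N.
Proof. by []. Qed.

Lemma fps_coef1 n : (1 : {fps R}) n = (n == 0%N)%:R.
Proof. by rewrite /=; case: (n == 0%N). Qed.

Lemma fps_coef0M f g : (f * g) 0%N = f 0%N * g 0%N.
Proof. by rewrite fps_coefM big_ord1. Qed.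

Lemma fps_coefCM c f n : (fpsC c * f) n = c * f n.
Proof.
rewrite fps_coefM big_ord_recl /= subn0 big1 ?addr0 // => i _.
by rewrite mul0r.
Qed.

Lemma fps_coefX_small f m n : f 0%N = 0 -> (n < m)%N -> (f ^+ m) n = 0.
Proof.
move=> f0; elim: m n => // m IHm n lt_nm; rewrite exprS fps_coefM.
rewrite big_ord_recl f0 mul0r add0r big1 // => i _.
have n_gt0 : (0 < n)%N by apply: leq_ltn_trans (ltn_ord i).
rewrite IHm ?mulr0 //; apply: leq_trans (lt_nm : (n <= m)%N).
by rewrite ltn_subrL.
Qed.

(* a(z) = \sum_i a_i z^i; the truncation is harmless when z has zero constant *)
(* term (z 0 = 0), because then z^i does not contribute to the n-th           *)
(* coefficient for i > n.  Only meaningful for such z.                        *)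
Definition fps_comp (a z : {fps R}) : {fps R} :=
  Fps (fun n => (\sum_(i < n.+1) fpsC (a i) * z ^+ i) n).

End FpsRing.

Arguments fpsX {R}.

Definition map_fps (R S : Type) (phi : R -> S) (f : {fps R}) : {fps S} :=
  Fps (fun n => phi (f n)).

Section FpsUnitRing.
Variable R : comUnitRingType.
Implicit Types f g h : {fps R}.

Definition fps_unit : {pred {fps R}} :=
  [pred f : {fps R} | f 0%N \is a GRing.unit].

(* f^-1 = f_0^-1 * \sum_i (1 - f_0^-1 f)^i *)
Definition fps_inv f : {fps R} :=
  if f \in fps_unit then
    fpsC (f 0%N)^-1 * fps_comp (Fps (fun=> 1)) (1 - fpsC (f 0%N)^-1 * f)
  else f.

Fact fps_geom h : h 0%N = 0 -> fps_comp (Fps (fun=> 1)) h * (1 - h) = 1.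
Proof.
move=> h0; apply: fpsP => n.
have eq_trunc m : (m <= n)%N ->
    (fps_comp (Fps (fun=> 1)) h) m = (\sum_(i < n.+1) h ^+ i) m.
  move=> le_mn; rewrite /fps_comp /= !fps_coef_sum /=.
  rewrite [RHS](bigID (fun i : 'I_n.+1 => (i < m.+1)%N)) /=.
  rewrite [X in _ = _ + X]big1 => [|i]; last first.
    by rewrite -leqNgt => le_mi; rewrite fps_coefX_small.
  rewrite addr0 (big_ord_widen n.+1 (fun i => (fpsC 1 * h ^+ i) m)) //.
  by apply: eq_bigr => i _; rewrite fps_coefCM mul1r.
transitivity (((\sum_(i < n.+1) h ^+ i) * (1 - h)) n).
  rewrite !fps_coefM; apply: eq_bigr => i _.
  by rewrite eq_trunc // -ltnS.
rewrite mulrC; have -> : (1 - h) * (\sum_(i < n.+1) h ^+ i) = 1 - h ^+ n.+1.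
  by rewrite -opprB mulNr -subrX1 opprB.
by rewrite fps_coefB fps_coefX_small // subr0.
Qed.

Fact fps_mulVx : {in fps_unit, left_inverse 1 fps_inv *%R}.
Proof.
move=> f f_unit; rewrite /fps_inv f_unit.
set c := fpsC _; set h := 1 - c * f.
have hE : 1 - h = c * f by rewrite /h opprB addrC subrK.
rewrite mulrAC -hE mulrC.
by apply: fps_geom; rewrite fps_coefB fps_coefCM mulVr ?subrr.
Qed.

Fact fps_unitPl f g : g * f = 1 -> fps_unit f.
Proof.
move/(congr1 (fun u : {fps R} => u 0%N)); rewrite fps_coef0M => gf1.
by apply/unitrPr; exists (g 0%N); rewrite mulrC.
Qed.

Fact fps_inv_out : {in [predC fps_unit], fps_inv =1 id}.
Proof. by move=> f; rewrite inE /= /fps_inv => /negPf ->. Qed.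

HB.instance Definition _ := GRing.ComNzRing_hasMulInverse.Build {fps R}
  fps_mulVx fps_unitPl fps_inv_out.
End FpsUnitRing.

(* The embedding Q[x, y] -> Q[[x, y]]; the outer variable is x on both sides. *)
Definition fps_of_poly2 (R : comNzRingType) (p : {poly {poly R}}) :
    {fps {fps R}} :=
  Fps (fun k => Fps (fun n => p`_k`_n)).

(* d is the least degree in T of a nonzero P(T) with coefficients in A such   *)
(* that P(u) = 0.  When A is an integral domain embedded by iota, clearing    *)
(* denominators shows that d is the degree of u over the fraction field of A. *)
Definition algebraic_of_degree (A B : nzRingType) (iota : A -> B)
    (u : B) (d : nat) : Prop :=
  (exists2 p : {poly A}, size p = d.+1 & root (map_poly iota p) u) /\
  (forall p : {poly A}, p != 0 -> root (map_poly iota p) u -> (d < size p)%N).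

(* Letters are numbered from 0: 'I_m stands for {1, ..., m}; avoidance only   *)
(* depends on the order of the letters.                                       *)
Definition avoids123 (m n : nat) (w : n.-tuple 'I_m) : bool :=
  ~~ [exists a : 'I_n, exists b : 'I_n, exists c : 'I_n,
      [&& (a < b)%N, (b < c)%N, (tnth w a < tnth w b)%N
        & (tnth w b < tnth w c)%N]].

Definition words123 (m n : nat) : {set n.-tuple 'I_m} :=
  [set w | avoids123 w].

(* Binomial coefficients with integer arguments, equal to 0 unless           *)
(* 0 <= b <= a; in particular 'C(i, r - i) with truncated subtraction would  *)
(* be wrong for r < i.                                                       *)
Definition binz (a b : int) : nat :=
  match a, b with
  | Posz a, Posz b => 'C(a, b)
  | _, _ => 0%N
  end.

Definition catalan (i : nat) : rat := 'C(i.*2, i)%:R / i.+1%:R.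

Definition catalan_gf : {fps rat} := Fps catalan.

Definition words123_gf : {fps {fps rat}} :=
  Fps (fun k => Fps (fun n => #|words123 (k + 2) n|%:R)).

(* C(z), for C with coefficients in Q and z in Q[[x, y]] *)
Definition catalan_at (z : {fps {fps rat}}) : {fps {fps rat}} :=
  fps_comp (map_fps (@fpsC rat) catalan_gf) z.

(* Main.v *)
From HB Require Import structures.
Require Import Defs.
From mathcomp Require Import all_boot all_order all_algebra.
From mathcomp Require Import ring zify.

Import GRing.Theory.
Local Open Scope ring_scope.

(**
A word is read from left to right, remembering two letters: [a], the least
letter so far, and [b], the least letter that ends a strict ascent so far (the
largest letter of the alphabet when there is none).  The next letter [w] is
harmless when [w <= a] (it becomes the new minimum), becomes the new [b] when
[a < w <= b], and completes a 123 when [w > b].  So the number [g n a b] of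
ways to append [n] letters obeys
  g (n+1) a b = sum_(j <= a) g n j b + sum_(a < e <= b) g n a e.
With the letters numbered 0, ..., k+1, a whole word may be thought of as
starting from the state [a = k], [b = k+1]: see [scanE] and [card_words123].

Put H_e = sum_(k, n) g n k (k+e+1) x^k y^n, so that F = H_0.  Differencing the
recurrence in [b] and then in [a] removes its sums ([state_gfS],
[state_gf0]):
  (1 + x - 2y) H_(e+1) = (1 - y) (H_e + x H_(e+2)),
  (1 + x - 2y) H_0     = (1 - y) (x H_0 + x H_1) + 1.
These determine all the H_e ([state_rec_uniq]).  A geometric progression
H_e = G t^e solves the first line as soon as
  (1 + x - 2y) t = (1 - y) (1 + x t^2),
and then the second line says t = (1-y) G / (1 + (1-y) x G).  Eliminating t,
the kernel equation becomes the quadratic equation for G in the theorem.  The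
closed form satisfies that quadratic because C(z) = 1 + z C(z)^2
([catalan_gfE]), hence F is the closed form ([words123_gf_closed]).

The quadratic has no other solution, since the difference of two solutions
is annihilated by a series with an invertible constant term
([equation_uniq]).  The sum formula is the expansion of the closed form, using
  y^i (1-y)^i / (1-2y)^(2i+1)
    = sum_s binom(i, s) y^(i+s) / (1-2y)^(i+s+1),
which is the binomial theorem for 1 - y = (1 - 2y) + y ([closed_form_coef]).
Finally F is not rational: otherwise the discriminant
(x - 1) (x - (1-2y)^2) of the quadratic would be a square up to a square
factor, yet x = 1 is a root of odd multiplicity ([odd_root_not_square],
[words123_gf_degree]).
*)

(** * Power series: coefficients, constants and composition *)

Section FpsTheory.
Variable R : comNzRingType.
Implicit Types (f g a b z : {fps R}) (p : {poly R}).

Lemma fpsC_is_zmod_morphism : zmod_morphism (@fpsC R).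
Proof. by move=> c d; apply: fpsP => -[|n] //=; rewrite subr0. Qed.

Lemma fpsC_is_monoid_morphism : monoid_morphism (@fpsC R).
Proof.
split=> // c d; apply: fpsP => n; rewrite fps_coefCM /=.
by case: ifP; rewrite ?mulr0.
Qed.

HB.instance Definition _ := GRing.isZmodMorphism.Build R {fps R} (@fpsC R)
  fpsC_is_zmod_morphism.
HB.instance Definition _ := GRing.isMonoidMorphism.Build R {fps R} (@fpsC R)
  fpsC_is_monoid_morphism.

Lemma fps_coefMn f k n : (f *+ k) n = f n *+ k.
Proof. by elim: k => [|k IHk]; rewrite ?mulr0n // !mulrS fps_coefD IHk. Qed.

Lemma fps_coefXM f n : (fpsX * f) n = if n is n'.+1 then f n' else 0.
Proof.
case: n => [|n]; first by rewrite fps_coef0M mul0r.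
rewrite fps_coefM big_ord_recl mul0r add0r big_ord_recl big1 => [|i _].
  by rewrite mul1r addr0 /= subn1.
by rewrite mul0r.
Qed.

Lemma fpsXI f g : fpsX * f = fpsX * g -> f = g.
Proof.
move=> /(congr1 (fun h : {fps R} => h _)) fg; apply: fpsP => n.
by have := fg n.+1; rewrite !fps_coefXM.
Qed.

Lemma coef_map_fpsC p i : (map_poly (@fpsC R) p)`_i = fpsC p`_i.
Proof. exact: coef_map. Qed.

(** Each coefficient of a composite depends on finitely many coefficients of
[a], so composition inherits the algebra of polynomial evaluation. *)
Lemma fps_comp_poly a z p n : z 0%N = 0 ->
    (forall i, (i <= n)%N -> p`_i = a i) ->
  fps_comp a z n = (map_poly (@fpsC R) p).[z] n.
Proof.
move=> z0 pa; set m := maxn n.+1 (size p).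
rewrite (@horner_coef_wide _ m); last first.
  exact: leq_trans (size_poly _ _) (leq_maxr _ _).
transitivity (\sum_(i < n.+1) (fpsC (a i) * z ^+ i) n).
  exact: fps_coef_sum.
rewrite (big_ord_widen m (fun i => (fpsC (a i) * z ^+ i) n)) ?leq_maxl //.
rewrite fps_coef_sum big_mkcond; apply: eq_bigr => i _.
rewrite coef_map_fpsC; case: ltnP => [|n_lt_i]; first by move/pa->.
by rewrite fps_coefCM fps_coefX_small ?mulr0.
Qed.

Lemma fps_compM a b z : z 0%N = 0 ->
  fps_comp (a * b) z = fps_comp a z * fps_comp b z.
Proof.
move=> z0; apply: fpsP => n.
pose trunc f : {poly R} := \poly_(i < n.+1) f i.
have truncE f i : (i <= n)%N -> (trunc f)`_i = f i.
  by move=> le_in; rewrite coef_poly ltnS le_in.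
rewrite (@fps_comp_poly _ _ (trunc a * trunc b)) //; last first.
  move=> i le_in; rewrite coefM fps_coefM; apply: eq_bigr => j _.
  have le_ji : (j <= i)%N by rewrite -ltnS.
  by rewrite !truncE ?(leq_trans _ le_in) ?leq_subr.
rewrite rmorphM hornerM !fps_coefM; apply: eq_bigr => j _.
by congr (_ * _); apply/esym/fps_comp_poly => // i ij; apply: truncE;
  rewrite (leq_trans ij) // ?leq_subr // -ltnS.
Qed.

Lemma fps_compD a b z : fps_comp (a + b) z = fps_comp a z + fps_comp b z.
Proof.
apply: fpsP => n; rewrite /fps_comp /= -fps_coefD -big_split /=.
by congr (fps_coef _ n); apply: eq_bigr => i _; rewrite rmorphD mulrDl.
Qed.

Lemma fps_comp1 z : z 0%N = 0 -> fps_comp 1 z = 1.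
Proof.
move=> z0; apply: fpsP => n.
rewrite (@fps_comp_poly _ _ 1) ?rmorph1 ?hornerC // => i _.
by rewrite coef1 fps_coef1.
Qed.

Lemma fps_compX z : z 0%N = 0 -> fps_comp fpsX z = z.
Proof.
move=> z0; apply: fpsP => n.
by rewrite (@fps_comp_poly _ _ 'X) ?map_polyX ?hornerX // => i _; rewrite coefX.
Qed.

(** The truncation index is uniform in the coefficients of [f * _] up to
[k], so composites can be expanded term by term after a multiplication. *)
Lemma fps_mul_comp_coef f a z k : z 0%N = 0 ->
  (f * fps_comp a z) k = \sum_(i < k.+1) a i * (f * z ^+ i) k.
Proof.
move=> z0; pose p := \poly_(i < k.+1) a i.
have -> : (f * fps_comp a z) k = (f * (map_poly (@fpsC R) p).[z]) k.
  rewrite !fps_coefM; apply: eq_bigr => j _; congr (_ * _).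
  apply: fps_comp_poly => // i ij.
  by rewrite coef_poly ltnS (leq_trans ij (leq_subr _ _)).
rewrite (@horner_coef_wide _ k.+1); last first.
  exact: leq_trans (size_poly _ _) (size_poly _ _).
rewrite mulr_sumr fps_coef_sum; apply: eq_bigr => i _.
by rewrite coef_map_fpsC coef_poly ltn_ord mulrCA fps_coefCM.
Qed.

(** The expansion of X^r / (1 - cX)^(r+1). *)
Definition binom_fps (c : R) (r : nat) : {fps R} :=
  Fps (fun n => c ^+ (n - r) *+ 'C(n, r)).

Lemma binom_fpsE c r :
  (1 - fpsC c * fpsX) ^+ r.+1 * binom_fps c r = fpsX ^+ r.
Proof.
have step f n : ((1 - fpsC c * fpsX) * f) n
    = f n - (if n is n'.+1 then c * f n' else 0).
  rewrite mulrBl mul1r fps_coefB -mulrA fps_coefCM fps_coefXM.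
  by case: n => //; rewrite mulr0.
(* Pascal's rule is the step from r to r+1 *)
elim: r => [|r IHr].
  apply: fpsP => n; rewrite expr1 expr0 step fps_coef1 /=.
  case: n => [|n]; first by rewrite subr0.
  by rewrite !subn0 !bin0 !mulr1n exprS subrr.
rewrite exprSr -mulrA.
have -> : (1 - fpsC c * fpsX) * binom_fps c r.+1 = fpsX * binom_fps c r.
  apply: fpsP => n; rewrite step fps_coefXM /=.
  case: n => [|n]; first by rewrite subr0.
  rewrite subSS binS mulrnDr; have [ltrn|lenr] := ltnP r n.
    by rewrite subnS mulrnAr -exprS prednK ?subn_gt0 // addrAC subrr add0r.
  by rewrite bin_small ?ltnS // !mulr0n mulr0 add0r subr0.
by rewrite mulrCA IHr exprS.
Qed.

End FpsTheory.

Lemma fps_coefYM (R : comNzRingType) (f : {fps {fps R}}) k n :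
  (fpsC fpsX * f) k n = if n is n'.+1 then f k n' else 0.
Proof. by rewrite fps_coefCM fps_coefXM. Qed.

Lemma fps_unitE (R : comUnitRingType) (f : {fps R}) :
  (f \is a GRing.unit) = (f 0%N \is a GRing.unit).
Proof. by []. Qed.

(** * The Catalan series *)

(** The derivation X d/dX; unlike d/dX it does not shift the coefficients. *)
Definition euler_op (R : comNzRingType) (f : {fps R}) : {fps R} :=
  Fps (fun n => f n *+ n).

Lemma euler_opM (R : comNzRingType) (f g : {fps R}) :
  euler_op R (f * g) = euler_op R f * g + f * euler_op R g.
Proof.
apply: fpsP => n; rewrite fps_coefD !fps_coefM -big_split /= -sumrMnl.
apply: eq_bigr => i _; rewrite mulrnAl mulrnAr -mulrnDr subnKC //.
by rewrite -ltnS.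
Qed.

Lemma catalanS (n : nat) :
  (n.+2)%:R * catalan n.+1 = (4 * n + 2)%:R * catalan n.
Proof.
have bin_step : (n.+1 * 'C(n.+1.*2, n.+1) = (4 * n + 2) * 'C(n.*2, n))%N.
  apply/eqP; rewrite -(eqn_pmul2l (ltn0Sn n)); apply/eqP.
  have h0 := mul_bin_diag n.*2.+2 n; have h1 := mul_bin_diag n.*2.+1 n.
  have h2 : 'C(n.*2.+1, n.+1) = 'C(n.*2.+1, n).
    by rewrite -[RHS]bin_sub; [congr 'C(_, _) | ]; lia.
  rewrite doubleS; move: h0 h1 h2; rewrite /= -!muln2; nia.
have nz m : (m.+1)%:R != 0 :> rat by rewrite Num.Theory.pnatr_eq0.
rewrite /catalan mulrCA mulfV // mulr1; apply: (mulfI (nz n)).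
rewrite -natrM bin_step natrM mulrCA; congr (_ * _).
by rewrite mulrCA mulfV ?mulr1.
Qed.

(** The closed form of the Catalan numbers says that b = 1 - 2XC satisfies
(1 - 4X) b' = -2b.  Hence (1 - 4X) (b^2)' = -4 b^2, a first-order recurrence
whose only solution with constant term 1 is b^2 = 1 - 4X, and this is the
quadratic equation of C multiplied by 4X. *)
Lemma catalan_gfE : catalan_gf = 1 + fpsX * catalan_gf ^+ 2.
Proof.
set c := catalan_gf; pose b : {fps rat} := 1 - 2%:R * (fpsX * c).
have coefMnat (k : nat) (f : {fps rat}) n : (k%:R * f) n = k%:R * f n.
  by rewrite !mulr_natl fps_coefMn.
have c0 : c 0%N = 1 by [].
have b0 : b 0%N = 1.
  by rewrite fps_coefB coefMnat fps_coefXM fps_coef1 mulr0 subr0.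
have bS n : b n.+1 = - (2%:R * c n).
  by rewrite fps_coefB coefMnat fps_coefXM fps_coef1 sub0r.
have odeE k (f : {fps rat}) :
    (1 - 4%:R * fpsX) * euler_op rat f = - (k%:R * (fpsX * f)) <->
    forall n, n.+1%:R * f n.+1 = (4%:R * n%:R - k%:R) * f n.
  have lhs n : ((1 - 4%:R * fpsX) * euler_op rat f) n.+1
      = n.+1%:R * f n.+1 - 4%:R * (n%:R * f n).
    by rewrite mulrBl mul1r -mulrA fps_coefB coefMnat fps_coefXM /= !mulr_natl.
  have rhs n : (- (k%:R * (fpsX * f))) n.+1 = - (k%:R * f n).
    by rewrite fps_coefN coefMnat fps_coefXM.
  split=> [ode n | rec].
    by have := lhs n; rewrite ode rhs mulrBl -mulrA => ->; ring.
  apply: fpsP => -[|n]; last by rewrite lhs rhs rec; ring.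
  rewrite mulrBl mul1r -mulrA fps_coefB fps_coefN !coefMnat !fps_coefXM /=.
  by rewrite !mulr0 subr0 oppr0.
have bode : (1 - 4%:R * fpsX) * euler_op rat b = - (2%:R * (fpsX * b)).
  apply/odeE => -[|n]; first by rewrite bS b0 c0; ring.
  rewrite !bS; have := catalanS n; rewrite natrD natrM => h.
  have -> : n.+2%:R * - (2%:R * c n.+1) = - 2%:R * (n.+2%:R * catalan n.+1).
    by rewrite /c /=; ring.
  by rewrite h /c /= -natr1; ring.
have /odeE bbS : (1 - 4%:R * fpsX) * euler_op rat (b ^+ 2)
    = - (4%:R * (fpsX * b ^+ 2)).
  rewrite expr2 euler_opM.
  transitivity (2%:R * b * ((1 - 4%:R * fpsX) * euler_op rat b)); first by ring.
  by rewrite bode; ring.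
have bb0 : (b ^+ 2) 0%N = 1 by rewrite expr2 fps_coef0M b0 mulr1.
have bb1 : (b ^+ 2) 1%N = - 4%:R.
  by have := bbS 0%N; rewrite bb0 => h; rewrite -[LHS]mul1r h; ring.
have bbSS n : (b ^+ 2) n.+2 = 0.
  have nz : n.+2%:R != 0 :> rat by rewrite Num.Theory.pnatr_eq0.
  apply: (mulfI nz); rewrite bbS mulr0; elim: n {nz} => [|n IHn].
    by rewrite mulr1 subrr mul0r.
  have nz : n.+2%:R != 0 :> rat by rewrite Num.Theory.pnatr_eq0.
  have /(mulfI nz) -> : n.+2%:R * (b ^+ 2) n.+2 = n.+2%:R * 0.
    by rewrite mulr0 bbS.
  by rewrite mulr0.
have bbE : b ^+ 2 = 1 - 4%:R * fpsX.
  apply: fpsP => n; rewrite fps_coefB coefMnat fps_coef1.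
  case: n => [|[|n]]; rewrite ?bb0 ?bb1 ?bbSS /=; ring.
have : 4%:R * (fpsX * (1 + fpsX * c ^+ 2)) = 4%:R * (fpsX * c).
  transitivity (b ^+ 2 - (1 - 4%:R * fpsX) + 4%:R * (fpsX * c)).
    by rewrite /b; ring.
  by rewrite bbE subrr add0r.
move=> h; apply: fpsXI; apply: fpsP => n.
have nz : 4%:R != 0 :> rat by [].
by apply: (mulfI nz); rewrite -!coefMnat h.
Qed.

(** * Counting 123-avoiding words by scanning *)

Section Scanning.
Local Open Scope nat_scope.

(** No 12 pattern of [s] lies strictly above [a]; equivalently, [a] followed by
[s] has no 123 whose 1 is that initial [a]. *)
Fixpoint no12_above (a : nat) (s : seq nat) : bool :=
  if s is w :: s' then
    ((a < w) ==> all (leq^~ w) s') && no12_above a s'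
  else true.

Fixpoint no123 (s : seq nat) : bool :=
  if s is w :: s' then no12_above w s' && no123 s' else true.

(** Acceptance of [s] by the automaton whose state consists of the least letter
[a] read so far and the least top [b] of an ascent read so far. *)
Fixpoint scan (a b : nat) (s : seq nat) : bool :=
  if s is w :: s' then
    if (w <= a) then scan w b s' else (w <= b) && scan a w s'
  else true.

Lemma no12_aboveP (a : nat) (s : seq nat) :
  reflect (forall i j, (i < j) -> (j < size s) -> (a < nth 0 s i) ->
             (nth 0 s j <= nth 0 s i))
          (no12_above a s).
Proof.
elim: s => [|w s IHs] /=; first by constructor => i j _; rewrite ltn0.
apply: (iffP andP) => [[/implyP aw /IHs IH] [|i] [|j] //= ij js ai | H].
- by have /(all_nthP 0) := aw ai; apply.
- exact: IH.
split; last by apply/IHs => i j ij js; apply: (H i.+1 j.+1).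
by apply/implyP => aw; apply/(all_nthP 0) => j js; apply: (H 0 j.+1).
Qed.

Lemma no123P (s : seq nat) :
  reflect (forall i j l, (i < j) -> (j < l) -> (l < size s) ->
             (nth 0 s i < nth 0 s j) -> (nth 0 s l <= nth 0 s j))
          (no123 s).
Proof.
elim: s => [|w s IHs] /=; first by constructor => i j l _ _; rewrite ltn0.
apply: (iffP andP) => [[/no12_aboveP H1 /IHs H2] [|i] [|j] [|l] //= |H].
- by move=> _; apply: (H1 j l).
- exact: (H2 i j l).
split; first by apply/no12_aboveP => i j ij js; apply: (H 0 i.+1 j.+1).
by apply/IHs => i j l ij jl ls; apply: (H i.+1 j.+1 l.+1).
Qed.

Lemma avoids123E (m n : nat) (w : n.-tuple 'I_m) :
  avoids123 w = no123 [seq val x | x <- w].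
Proof.
have nthE (i : 'I_n) : nth 0 [seq val x | x <- w] i = tnth w i.
  by rewrite (nth_map (tnth w i)) ?size_tuple // -tnth_nth.
have szE : size [seq val x | x <- w] = n by rewrite size_map size_tuple.
apply/negP/no123P => [H i j l ij jl | H].
  rewrite szE => ln; have jn := ltn_trans jl ln; have iN := ltn_trans ij jn.
  have /= -> := nthE (Ordinal iN); have /= -> := nthE (Ordinal jn).
  have /= -> := nthE (Ordinal ln) => wij; rewrite leqNgt; apply/negP => wjl.
  apply: H; apply/existsP; exists (Ordinal iN); apply/existsP.
  exists (Ordinal jn); apply/existsP; exists (Ordinal ln).
  by rewrite /= ij jl wij.
case/existsP => a /existsP[b /existsP[c /and4P[ab bc wab wbc]]].
have := H a b c ab bc; rewrite szE !nthE => /(_ (ltn_ord c) wab).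
by rewrite leqNgt wbc.
Qed.

Lemma no12_above_le (a w : nat) (s : seq nat) :
  (w <= a) -> no12_above w s -> no12_above a s.
Proof.
move=> wa; elim: s => //= u s IHs /andP[/implyP H1 /IHs ->]; rewrite andbT.
by apply/implyP => au; apply: H1; apply: leq_ltn_trans au.
Qed.

(** A 12 pattern above [a] needs two letters above [a]. *)
Lemma no12_above_max (a b : nat) (s : seq nat) :
  (b <= a.+1) -> all (leq^~ b) s -> no12_above a s.
Proof.
move=> ba; elim: s => //= u s IHs /andP[ub sb]; rewrite IHs // andbT.
apply/implyP => au; apply: sub_all sb => x /= xb.
by apply: leq_trans xb (leq_trans ba au).
Qed.

(** The past matters only through [a], which may serve as the 1 of a 123, and
through [b], which bounds all later letters.  A letter [w <= a] takes over the
role of [a], because it starts every pattern that [a] could start. *)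
Lemma scanE (a b : nat) (s : seq nat) : (a <= b) ->
  scan a b s = all (leq^~ b) s && no123 (a :: s).
Proof.
elim: s a b => //= w s IHs a b ab; case: leqP => [wa | aw] /=.
  rewrite (leq_trans wa ab) IHs ?(leq_trans wa) //=.
  case: (all _ s) => //=.
  by case: (boolP (no12_above w s)) => [/(no12_above_le _ _ _ wa) ->|];
    rewrite ?andbF.
case: (leqP w b) => //= wb; rewrite IHs 1?ltnW //=.
have [sw|] := boolP (all _ s); last by rewrite !andbF.
rewrite (no12_above_max _ _ _ (leqnSn w) sw) /=.
suff -> : all (leq^~ b) s by [].
by apply: sub_all sw => x /= /leq_trans; apply.
Qed.

Fixpoint scan_count (n a b : nat) : nat :=
  if n is n'.+1 then
    (\sum_(j < a.+1) scan_count n' j b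
     + \sum_(a.+1 <= e < b.+1) scan_count n' a e)
  else 1.

Lemma big_tupleS (T : finType) (n : nat) (F : n.+1.-tuple T -> nat) :
  \sum_w F w = \sum_(x : T) \sum_(v : n.-tuple T) F [tuple of x :: v].
Proof.
rewrite pair_bigA /=.
rewrite (reindex (fun p : T * n.-tuple T => [tuple of p.1 :: p.2])) //=.
exists (fun w => (thead w, [tuple of behead w])) => [[x v] _ | w _] /=.
  by rewrite theadE; congr pair; apply: val_inj.
by rewrite -tuple_eta.
Qed.

Lemma card_scan (m n a b : nat) : (a <= b < m) ->
  \sum_(w : n.-tuple 'I_m) scan a b [seq val x | x <- w]
  = scan_count n a b.
Proof.
elim: n a b => [|n IHn] a b /andP[ab bm].
  rewrite (bigD1 [tuple]) //= big1 // => w /eqP; case.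
  exact: tuple0.
rewrite big_tupleS /=.
rewrite -(big_mkord xpredT (fun j => scan_count n j b)).
transitivity (\sum_(0 <= w < m)
   (if w <= a then scan_count n w b else
    if w <= b then scan_count n a w else 0)).
  rewrite big_mkord; apply: eq_bigr => x _.
  case: leqP => [xa | ax]; first by rewrite IHn // (leq_trans xa).
  case: leqP => [xb | bx] /=; last by rewrite big1.
  by rewrite IHn // ltn_ord ltnW.
rewrite (big_cat_nat (n := b.+1)) //= [X in (_ + X)]big_nat_cond.
rewrite [X in (_ + X)]big1 ?addn0 => [|w]; last first.
  rewrite andbT => /andP[bw _].
  by rewrite (leqNgt w a) (leqNgt w b) bw (leq_ltn_trans ab bw).
rewrite (big_cat_nat (n := a.+1)) //=; congr addn; rewrite !big_nat.
  by apply: eq_bigr => w /andP[_]; rewrite ltnS => ->.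
by apply: eq_bigr => w /andP[aw wb]; rewrite leqNgt aw -ltnS wb.
Qed.

(** Starting from [a = k] and [b = k+1] forbids nothing: no letter exceeds
[k+1], and no ascent fits strictly above [k]. *)
Lemma card_words123 (k n : nat) :
  #|words123 (k + 2) n| = scan_count n k k.+1.
Proof.
rewrite addn2 -(card_scan k.+2) ?leqnSn ?ltnSn // -sum1_card big_mkcond /=.
apply: eq_bigr => w _; rewrite inE avoids123E scanE ?leqnSn //=.
have wb : all (leq^~ k.+1) [seq val x | x <- w].
  by rewrite all_map; apply/allP => x _ /=; rewrite -ltnS.
by rewrite wb (no12_above_max _ _ _ (leqnn _) wb); case: no123.
Qed.

End Scanning.

(** * Generating functions of the scanning states *)

(** Indexing by the gap [e] makes the recurrence linear with constant
coefficients, since moving along a diagonal of fixed [b] is then a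
multiplication by x. *)
Definition state_gf (e : nat) : {fps {fps rat}} :=
  Fps (fun k => Fps (fun n => (scan_count n k (k + e).+1)%:R)).

Lemma words123_gfE : words123_gf = state_gf 0.
Proof.
apply: fpsP => k; apply: fpsP => n.
by rewrite /= card_words123 addn0.
Qed.

(** In the second sum of the recurrence, raising [b] only adds the term of the
first letter [b+1]. *)
Lemma scan_countS (n a b : nat) : (a <= b)%N ->
  (scan_count n.+1 a b.+1 + \sum_(j < a.+1) scan_count n j b
   = scan_count n.+1 a b + \sum_(j < a.+1) scan_count n j b.+1
     + scan_count n a b.+1)%N.
Proof. by move=> ab /=; rewrite big_nat_recr //=; lia. Qed.

(** This is the difference of [scan_countS] at [a] and at [a-1], which removes
the sum over the new minimum [j]. *)
Lemma state_gfS (e : nat) :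
  let x := fpsX in let y := fpsC fpsX in
  (1 + x - 2%:R * y) * state_gf e.+1
  = (1 - y) * (state_gf e + x * state_gf e.+2).
Proof.
move=> x y; set f := state_gf e; set g := state_gf e.+1.
set h := state_gf e.+2.
(* each side moved so that its coefficients are sums of natural numbers *)
suff rec : g + x * g + y * f + y * (x * h) = f + x * h + y * g + y * g.
  transitivity (g + x * g + y * f + y * (x * h)
    - (y * f + y * (x * h) + y * g + y * g)); first by ring.
  by rewrite rec; ring.
apply: fpsP => k; apply: fpsP => n.
rewrite !fps_coefD !fps_coefYM !fps_coefXM.
case: n => [|n]; first by case: k => [|k]; rewrite /= ?addr0.
case: k => [|k].
  have := scan_countS n 0 (0 + e).+1 isT; rewrite !big_ord1.
  rewrite !addr0 -!natrD !addnS !add0n => count.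
  by congr _%:R; move: count; rewrite /=; lia.
have kb : (k.+1 <= (k + e.+1).+1)%N by lia.
have := scan_countS n k (k + e.+1).+1 (ltnW kb).
have := scan_countS n k.+1 (k + e.+1).+1 kb.
rewrite !(big_ord_recr k.+1) /= -!natrD.
rewrite !addnS !addSn => h1 h2; congr _%:R; lia.
Qed.

(** The boundary case [b = a+1], where few letters lie above [a]: only k+1 for
the state (k, k+1), and k and k+1 for the state (k-1, k+1). *)
Lemma state_gf0 :
  let x := fpsX in let y := fpsC fpsX in
  (1 + x - 2%:R * y) * state_gf 0
  = (1 - y) * (x * state_gf 0 + x * state_gf 1) + 1.
Proof.
move=> x y; set f := state_gf 0; set g := state_gf 1.
suff rec : f + y * (x * f) + y * (x * g) = x * g + y * f + y * f + 1.
  transitivity (f + y * (x * f) + y * (x * g)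
    + (x * f  - 2%:R * y * f - y * (x * f) - y * (x * g))); first by ring.
  by rewrite rec; ring.
apply: fpsP => k; apply: fpsP => n.
rewrite !fps_coefD !fps_coefYM !fps_coefXM.
have coef1 : (1 : {fps {fps rat}}) k n = ((k == 0%N) && (n == 0%N))%:R.
  by rewrite fps_coef1; case: k => [|k]; rewrite ?fps_coef1.
rewrite {}coef1; case: n => [|n].
  by case: k => [|k]; rewrite /= ?addr0 ?add0r.
case: k => [|k]; rewrite andbF addr0.
  rewrite !addr0 !add0r -!natrD; congr _%:R.
  by rewrite /= big_ord1 big_nat1.
rewrite -!natrD; congr _%:R.
rewrite /= !addn0 !addn1 (big_ord_recr k.+1) big_nat1.
rewrite (@big_ltn _ _ _ k.+1) // big_nat1 /=.
by lia.
Qed.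

(** Every factor x lowers the degree in x, so at fixed degree in x the system
is triangular in [e], with the unit [p] on its diagonal. *)
Lemma state_rec_uniq (R : comUnitRingType) (p q : R) (D : nat -> {fps R}) :
    p \is a GRing.unit ->
    (fpsC p + fpsX) * D 0%N = fpsC q * (fpsX * D 0%N + fpsX * D 1%N) ->
    (forall e, (fpsC p + fpsX) * D e.+1
               = fpsC q * (D e + fpsX * D e.+2)) ->
  forall e, D e = 0.
Proof.
move=> pU D0 DS e; apply: fpsP => k; elim: k e => [|k IHk] e.
all: have XD i j : (fpsX * D i) j = if j is j'.+1 then D i j' else 0
  by exact: fps_coefXM.
- elim: e => [|e IHe]; apply: (mulrI pU); rewrite mulr0.
    have := congr1 (fun h => fps_coef h 0%N) D0.
    by rewrite mulrDl fps_coefD !fps_coefCM fps_coefD !XD !addr0 mulr0.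
  have := congr1 (fun h => fps_coef h 0%N) (DS e).
  by rewrite mulrDl fps_coefD !fps_coefCM fps_coefD !XD IHe !addr0 mulr0.
elim: e => [|e IHe]; apply: (mulrI pU); rewrite mulr0.
  have := congr1 (fun h => fps_coef h k.+1) D0.
  by rewrite mulrDl fps_coefD !fps_coefCM fps_coefD !XD !IHk !addr0 mulr0.
have := congr1 (fun h => fps_coef h k.+1) (DS e).
by rewrite mulrDl fps_coefD !fps_coefCM fps_coefD !XD IHe !IHk !addr0 mulr0.
Qed.

(** * Polynomials as power series, and an obstruction to being a square *)

(** Infinite descent: [r] is a root of [q], then of [p], and both can be divided
by ['X - r%:P]. *)
Lemma odd_root_not_square (R : idomainType) (r : R) (e p q : {poly R}) :
  ~~ root e r -> p ^+ 2 * ('X - r%:P) * e = q ^+ 2 -> p = 0.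
Proof.
move=> er; have [m] := ubnP (size p); elim: m p q => // m IHm p q.
rewrite ltnS => pm pq; apply/eqP; apply: contraT => p0.
have Xr0 : 'X - r%:P != 0 by rewrite polyXsubC_eq0.
have /factor_theorem[q' qE] : root q r.
  have : root (q ^+ 2) r by rewrite -pq !rootM root_XsubC eqxx orbT.
  by rewrite expr2 rootM orbb.
have pq' : p ^+ 2 * e = q' ^+ 2 * ('X - r%:P).
  by apply: (mulIf Xr0); rewrite mulrAC pq qE; ring.
have /factor_theorem[p' pE] : root p r.
  have : root (p ^+ 2 * e) r by rewrite pq' rootM root_XsubC eqxx orbT.
  by rewrite rootM (negPf er) orbF expr2 rootM orbb.
have p'q : p' ^+ 2 * ('X - r%:P) * e = q' ^+ 2.
  by apply: (mulIf Xr0); rewrite -pq' pE; ring.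
have p'0 : p' != 0 by apply: contraNneq p0 => p'0; rewrite pE p'0 mul0r.
have p'm : (size p' < m)%N.
  by rewrite (leq_trans _ pm) // pE size_Mmonic ?monicXsubC // size_XsubC addn2.
by case/eqP: p'0; apply: IHm p'm p'q.
Qed.

Lemma horner_map_deg2 (A B : comNzRingType) (f : {rmorphism A -> B})
    (a b c : A) (u : B) :
  (map_poly f ((a%:P * 'X + b%:P) * 'X + c%:P)).[u]
  = f a * u ^+ 2 + f b * u + f c.
Proof.
rewrite !(rmorphD, rmorphM) /= !map_polyC !map_polyX /= !hornerE /=.
by ring.
Qed.

Section PolyEmbedding.
Variable R : comNzRingType.

Lemma fps_of_poly2_is_zmod_morphism : zmod_morphism (@fps_of_poly2 R).
Proof.
by move=> p q; apply: fpsP => k; apply: fpsP => n; rewrite /= !coefB.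
Qed.

Lemma fps_of_poly2_is_monoid_morphism : monoid_morphism (@fps_of_poly2 R).
Proof.
split=> [|p q]; apply: fpsP => k; apply: fpsP => n.
  rewrite fps_coef1 /= coef1.
  by case: k => [|k]; rewrite ?coef0 ?coef1 ?fps_coef1.
rewrite /= coefM coef_sum fps_coef_sum; apply: eq_bigr => i _.
by rewrite coefM fps_coefM.
Qed.

HB.instance Definition _ := GRing.isZmodMorphism.Build _ _ (@fps_of_poly2 R)
  fps_of_poly2_is_zmod_morphism.
HB.instance Definition _ := GRing.isMonoidMorphism.Build _ _ (@fps_of_poly2 R)
  fps_of_poly2_is_monoid_morphism.

Lemma fps_of_poly2_inj : injective (@fps_of_poly2 R).
Proof.
move=> p q pq; apply/polyP => k; apply/polyP => n.
exact: (congr1 (fun f : {fps {fps R}} => f k n) pq).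
Qed.

Lemma fps_of_poly2X : fps_of_poly2 'X = fpsX :> {fps {fps R}}.
Proof.
apply: fpsP => k; apply: fpsP => n; rewrite /= coefX.
by case: (k == 1%N); rewrite ?coef0 ?coef1 ?fps_coef1.
Qed.

Lemma fps_of_poly2CX : fps_of_poly2 'X%:P = fpsC fpsX :> {fps {fps R}}.
Proof.
apply: fpsP => k; apply: fpsP => n; rewrite /= coefC.
by case: (k == 0%N); rewrite ?coef0 ?coefX.
Qed.
End PolyEmbedding.

(** * The closed form and its quadratic equation *)

Lemma catalan_at_eq (z : {fps {fps rat}}) : z 0%N = 0 ->
  catalan_at z = 1 + z * catalan_at z ^+ 2.
Proof.
move=> z0; rewrite /catalan_at; set c := map_fps _ _.
have {1}-> : c = 1 + fpsX * (c * c).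
  apply: fpsP => n; rewrite fps_coefD fps_coefXM fps_coef1.
  have -> : c n = fpsC (catalan_gf n) by [].
  have := congr1 (fun f : {fps rat} => fps_coef f n) catalan_gfE.
  rewrite fps_coefD fps_coefXM fps_coef1 => ->; rewrite rmorphD rmorph_nat.
  case: n => [|n]; first by rewrite rmorph0.
  rewrite expr2 fps_coefM rmorph_sum fps_coefM; congr (_ + _).
  by apply: eq_bigr => i _; rewrite rmorphM.
by rewrite fps_compD fps_comp1 // !fps_compM // fps_compX // expr2.
Qed.

Section ClosedForm.
Let x : {fps {fps rat}} := fpsX.
Let y : {fps {fps rat}} := fpsC fpsX.
Let q : {fps {fps rat}} := (1 - x) * (1 - 2%:R * y).
Let z : {fps {fps rat}} := x * y * (1 - y) / ((1 - x) * (1 - 2%:R * y) ^+ 2).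
Let G : {fps {fps rat}} := q^-1 * catalan_at z.
Let equation (H : {fps {fps rat}}) : Prop :=
  x * (1 - x) * y * (1 - y) * H ^+ 2 - (1 - x) * (1 - 2%:R * y) * H + 1 = 0.

Lemma closed_form_units :
  1 - x \is a GRing.unit /\ 1 - 2%:R * y \is a GRing.unit.
Proof.
split; rewrite fps_unitE fps_coefB; first by rewrite subr0 unitr1.
rewrite mulr_natl fps_coefMn fps_unitE fps_coefB fps_coefMn.
by rewrite mul0rn subr0 unitr1.
Qed.

(** With q = (1-x)(1-2y), z q^2 = x(1-x)y(1-y), so the quadratic of G = C(z)/q
is that of C(z). *)
Lemma closed_form_eq : equation G.
Proof.
have [ux uy] := closed_form_units.
have uq : q \is a GRing.unit by rewrite unitrM ux.
have uz : (1 - x) * (1 - 2%:R * y) ^+ 2 \is a GRing.unit.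
  by rewrite unitrM ux unitrX.
have z0 : z 0%N = 0 by rewrite /z -!mulrA fps_coef0M mul0r.
have GE : q * G = catalan_at z by rewrite /G mulVKr.
have zE : z * q ^+ 2 = x * (1 - x) * y * (1 - y).
  have -> : q ^+ 2 = (1 - x) * (1 - 2%:R * y) ^+ 2 * (1 - x).
    by rewrite /q; ring.
  by rewrite /z mulrA divrK //; ring.
rewrite /equation -zE -/q -mulrA -exprMn GE.
by rewrite [X in _ - X + _](catalan_at_eq _ z0); ring.
Qed.

(** The quadratic takes the form x(...)H^2 - qH + 1, and the difference of its
values at H and G is (H - G) times a series that is -(1 - 2y) at x = 0, a
unit. *)
Lemma equation_uniq (H : {fps {fps rat}}) : equation H -> H = G.
Proof.
move=> eH; have eG := closed_form_eq; have [ux uy] := closed_form_units.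
pose w := x * (1 - x) * y * (1 - y) * (H + G) - q.
have uw : w \is a GRing.unit.
  have -> : w = x * ((1 - x) * y * (1 - y) * (H + G) + (1 - 2%:R * y))
                - (1 - 2%:R * y) by rewrite /w /q; ring.
  by rewrite fps_unitE fps_coefB fps_coef0M mul0r sub0r unitrN.
apply/eqP; rewrite -subr_eq0; apply/eqP; apply: (mulrI uw).
rewrite mulr0 -[RHS](subrr 0) -{1}eH -eG /w /q; ring.
Qed.

(** The progression G t^e satisfies the two equations that characterize the
state series, so it equals them, and e = 0 gives F. *)
Lemma words123_gf_closed : words123_gf = G.
Proof.
have eG := closed_form_eq; have [ux uy] := closed_form_units.
(* the ratio t is forced by the boundary equation: see the introduction *)
pose p : {fps {fps rat}} := 1 - y; pose u := 1 + p * x * G.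
have uu : u \is a GRing.unit.
  rewrite fps_unitE fps_coefD -mulrA mulrCA fps_coef0M mul0r addr0.
  exact: unitr1.
pose t := p * G / u; have tu : t * u = p * G by rewrite divrK.
have et : (1 + x - 2%:R * y) * t = p * (1 + x * t ^+ 2).
  apply: (mulIr (unitrX 2 uu)); apply/eqP; rewrite -subr_eq0; apply/eqP.
  transitivity ((1 + x - 2%:R * y) * (t * u) * u
                - p * (u ^+ 2 + x * (t * u) ^+ 2)); first by ring.
  rewrite tu -[RHS](mulr0 (- p)) -eG /u /p; ring.
have e0 : (1 + x - 2%:R * y) * G = p * (x * G + x * (G * t)) + 1.
  apply: (mulIr uu); apply/eqP; rewrite -subr_eq0; apply/eqP.
  transitivity ((1 + x - 2%:R * y) * G * u
                - p * x * G * (u + t * u) - u); first by ring.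
  rewrite tu -[RHS](mulr0 (- 1)) -eG /u /p; ring.
have xyE : fpsC (1 - 2%:R * fpsX) + fpsX = 1 + x - 2%:R * y.
  by rewrite rmorphB rmorph1 rmorphM rmorph_nat -/y -/x; ring.
have pE : fpsC (1 - fpsX) = p by rewrite rmorphB rmorph1.
rewrite words123_gfE; apply/eqP; rewrite -subr_eq0; apply/eqP.
rewrite -[G]mulr1 -(expr0 t).
apply: (state_rec_uniq _ (1 - 2%:R * fpsX) (1 - fpsX)
          (fun e => state_gf e - G * t ^+ e)) => [||e].
- rewrite fps_unitE fps_coefB mulr_natl fps_coefMn mul0rn subr0.
  exact: unitr1.
- rewrite xyE pE expr0 mulr1 expr1 !mulrBr state_gf0 e0 -/x -/y /p; ring.
rewrite xyE pE !mulrBr state_gfS -/x -/y -/p.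
have -> : (1 + x - 2%:R * y) * (G * t ^+ e.+1)
    = G * t ^+ e * ((1 + x - 2%:R * y) * t) by rewrite exprS; ring.
by rewrite et !exprS; ring.
Qed.

(** * Coefficients of the closed form *)

(** The i-th term of C(z)/q is a product of x^i / (1-x)^(i+1) and
y^i (1-y)^i / (1-2y)^(2i+1); the latter is expanded by writing
1 - y = (1 - 2y) + y. *)
Lemma closed_form_coef (k n : nat) :
  G k n = \sum_(i < k.+1) catalan i * 'C(k, i)%:R
            * \sum_(s < i.+1) 'C(i, s)%:R
                * (2%:R ^+ (n - (i + s)) * 'C(n, i + s)%:R).
Proof.
have [ux uy] := closed_form_units.
have uq : q \is a GRing.unit by rewrite unitrM ux.
have uz : (1 - x) * (1 - 2%:R * y) ^+ 2 \is a GRing.unit.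
  by rewrite unitrM ux unitrX.
have z0 : z 0%N = 0 by rewrite /z -!mulrA fps_coef0M mul0r.
pose A i : {fps rat} :=
  \sum_(s < i.+1) 'C(i, s)%:R * binom_fps rat 2%:R (i + s).
have AE i : (1 - 2%:R * fpsX) ^+ (i.*2).+1 * A i = fpsX ^+ i * (1 - fpsX) ^+ i.
  have -> : (1 - fpsX) ^+ i = \sum_(s < i.+1)
      'C(i, s)%:R * ((1 - 2%:R * fpsX) ^+ (i - s) * fpsX ^+ s) :> {fps rat}.
    have -> : 1 - fpsX = (1 - 2%:R * fpsX) + fpsX :> {fps rat} by ring.
    by rewrite exprDn; apply: eq_bigr => s _; rewrite [RHS]mulr_natl.
  rewrite !mulr_sumr; apply: eq_bigr => s _.
  have le_si : (s <= i)%N by rewrite -ltnS.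
  have -> : (i.*2).+1 = ((i - s) + (i + s).+1)%N by rewrite -addnn; lia.
  have h := binom_fpsE rat 2%:R (i + s); rewrite rmorph_nat in h.
  by rewrite exprD mulrCA -mulrA h exprD; ring.
(* both sides are cleared of denominators *)
have term i : q^-1 * z ^+ i = binom_fps {fps rat} 1 i * fpsC (A i).
  have uw : q * ((1 - x) * (1 - 2%:R * y) ^+ 2) ^+ i \is a GRing.unit.
    by rewrite unitrM uq unitrX.
  apply: (mulrI uw); rewrite -mulrA (mulrCA _ q^-1) mulVKr //.
  rewrite -exprMn mulrCA divrr // mulr1.
  have -> : q * ((1 - x) * (1 - 2%:R * y) ^+ 2) ^+ i
      = (1 - x) ^+ i.+1 * (1 - 2%:R * y) ^+ (i.*2).+1.
    by rewrite exprMn -exprM mul2n !exprS /q; ring.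
  rewrite mulrACA; have -> : 1 - x = 1 - fpsC 1 * fpsX by rewrite rmorph1 mul1r.
  rewrite binom_fpsE; have -> : 1 - 2%:R * y = fpsC (1 - 2%:R * fpsX).
    by rewrite rmorphB rmorph1 rmorphM rmorph_nat.
  rewrite -rmorphXn -rmorphM AE rmorphM !rmorphXn rmorphB rmorph1 -/y.
  by rewrite !exprMn mulrA.
rewrite /G fps_mul_comp_coef // fps_coef_sum; apply: eq_bigr => i _.
have -> : map_fps (@fpsC rat) catalan_gf i = fpsC (catalan i) by [].
have binomE : binom_fps {fps rat} 1 i k = 'C(k, i)%:R by rewrite /= expr1n.
rewrite term [_ * fpsC (A i)]mulrC !fps_coefCM binomE [A i * _]mulr_natr.
rewrite fps_coefMn.
rewrite fps_coef_sum -mulrA mulr_natl; congr (_ * (_ *+ _)).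
apply: eq_bigr => s _.
by rewrite !mulr_natl mulr_natr fps_coefMn.
Qed.

(** The substitution r = i + s; both ranges are compared with a common longer
one, on which the extra terms vanish. *)
Lemma sum_binz (n i : nat) :
  \sum_(r < n.+1) 2%:R ^+ (n - r) * (binz i%:Z (r%:Z - i%:Z))%:R * 'C(n, r)%:R
  = \sum_(s < i.+1) 'C(i, s)%:R * (2%:R ^+ (n - (i + s)) * 'C(n, i + s)%:R)
    :> rat.
Proof.
pose t r : rat :=
  2%:R ^+ (n - r) * (binz i%:Z (r%:Z - i%:Z))%:R * 'C(n, r)%:R.
have t_small r : (r < i)%N -> t r = 0.
  move=> ri; rewrite /t; suff -> : binz i%:Z (r%:Z - i%:Z) = 0%N.
    by rewrite mulr0 mul0r.
  have -> : r%:Z - i%:Z = Negz (i - r).-1 by lia.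
  by [].
have tD s : t (i + s)%N
    = 'C(i, s)%:R * (2%:R ^+ (n - (i + s)) * 'C(n, i + s)%:R).
  rewrite /t; have -> : (i + s)%N%:Z - i%:Z = s%:Z by lia.
  by rewrite mulrAC mulrC.
have t_large r : (i + i < r)%N -> t r = 0.
  move=> ir; have -> : r = (i + (r - i))%N by lia.
  by rewrite tD bin_small ?mul0r //; lia.
have t_gt_n r : (n < r)%N -> t r = 0.
  by move=> nr; rewrite /t (bin_small nr) mulr0.
pose N := (n.+1 + (i + i.+1))%N.
have widen m : (m <= N)%N -> (forall r, (m <= r)%N -> t r = 0) ->
    \sum_(0 <= r < m) t r = \sum_(0 <= r < N) t r.
  move=> mN t0; rewrite (big_cat_nat (n := m) (p := N)) //=.
  rewrite [X in _ + X]big_nat_cond [X in _ + X]big1 ?addr0 // => r.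
  by case/andP=> /andP[mr _] _; apply: t0.
rewrite -(big_mkord xpredT t) widen ?leq_addr //.
rewrite -(widen (i + i.+1)%N) ?leq_addl //; last first.
  by move=> r; rewrite addnS; apply: t_large.
rewrite (big_cat_nat (n := i)) ?leq_addr //= big_nat_cond.
rewrite big1 ?add0r; last first.
  by move=> r /andP[/andP[_ ri] _]; apply: t_small.
rewrite -{1}[i]add0n big_addn addnC addnK big_mkord.
by apply: eq_bigr => s _; rewrite addnC tD.
Qed.

Lemma card_words123_sum (n k : nat) :
  #|words123 (k + 2) n|%:R =
  \sum_(r < n.+1) \sum_(i < k.+1)
     2%:R ^+ (n - r) * catalan i * (binz i%:Z (r%:Z - i%:Z))%:R
     * (binz n%:Z r%:Z)%:R * (binz k%:Z i%:Z)%:R :> rat.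
Proof.
transitivity (words123_gf k n); first by [].
rewrite words123_gf_closed closed_form_coef exchange_big /=.
apply: eq_bigr => i _; rewrite -sum_binz mulr_sumr; apply: eq_bigr => r _.
by ring.
Qed.

(** * Degree over the rational functions *)

(** If p1 F + p0 = 0, multiplying the completed square
(2AF - B)^2 = B^2 - 4A by p1^2 gives p1^2 (B^2 - 4A) = (2 A p0 + B p1)^2, an
identity between polynomials, where B^2 - 4A = (x - 1) (x - (1-2y)^2). *)
Lemma words123_gf_degree :
  algebraic_of_degree (@fps_of_poly2 rat) words123_gf 2.
Proof.
have eF : equation words123_gf.
  by rewrite words123_gf_closed; exact: closed_form_eq.
pose iota : {rmorphism {poly {poly rat}} -> {fps {fps rat}}} :=
  @fps_of_poly2 rat.
pose X : {poly {poly rat}} := 'X; pose Y : {poly {poly rat}} := 'X%:P.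
pose A := X * (1 - X) * Y * (1 - Y); pose B := (1 - X) * (1 - 2%:R * Y).
have iX : iota X = x by exact: fps_of_poly2X.
have iY : iota Y = y by exact: fps_of_poly2CX.
have iA : iota A = x * (1 - x) * y * (1 - y).
  by rewrite /A !(rmorphM, rmorphB, rmorph1) iX iY.
have iB : iota B = (1 - x) * (1 - 2%:R * y).
  by rewrite /B !(rmorphM, rmorphB, rmorph1, rmorph_nat) iX iY.
have eAB : iota A * words123_gf ^+ 2 - iota B * words123_gf + 1 = 0.
  by rewrite iA iB.
have subX0 (S : idomainType) : 1 - 'X != 0 :> {poly S}.
  by rewrite -oppr_eq0 opprB -polyC1 polyXsubC_eq0.
have A0 : A != 0.
  rewrite /A !mulf_neq0 ?polyX_eq0 ?subX0 ?polyC_eq0 ?polyX_eq0 //.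
  by rewrite /Y -polyC1 -polyCB polyC_eq0 subX0.
(* A and B are made opaque so that iota stops at them *)
clearbody A B.
split.
  exists ((A%:P * 'X + (- B)%:P) * 'X + 1%:P).
    rewrite size_MXaddC oner_eq0 andbF size_MXaddC polyC_eq0 (negPf A0) /=.
    by rewrite size_polyC A0.
  by rewrite /root (horner_map_deg2 _ _ iota) rmorph1 -eAB rmorphN mulNr.
move=> p p0 rp; rewrite ltnNge; apply: contraNN p0 => szp.
have pE : p = (p`_1)%:P * 'X + (p`_0)%:P.
  apply/polyP => i; rewrite coefD coefMX !coefC.
  case: i => [|[|i]] /=; rewrite ?add0r ?addr0 //.
  by rewrite nth_default // (leq_trans szp).
have lin : iota p`_1 * words123_gf + iota p`_0 = 0.
  have := horner_map_deg2 _ _ iota 0 p`_1 p`_0 words123_gf.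
  rewrite !(rmorph0, mul0r, add0r) -pE => <-.
  exact/eqP.
have sq : p`_1 ^+ 2 * ('X - 1%:P) * (X - (1 - 2%:R * Y) ^+ 2)
    = (2%:R * A * p`_0 + B * p`_1) ^+ 2.
  apply: (@fps_of_poly2_inj rat); rewrite -[@fps_of_poly2 rat]/(iota : _ -> _).
  rewrite !(rmorphM, rmorphB, rmorphD, rmorphXn, rmorph1, rmorph_nat) iX iY.
  rewrite iA iB; have := eAB; rewrite iA iB => eAB'.
  have -> : iota p`_0 = - (iota p`_1 * words123_gf).
    by apply/eqP; rewrite -addr_eq0 addrC lin.
  apply/eqP; rewrite -subr_eq0; apply/eqP.
  rewrite -[RHS](mulr0 (- (4%:R * iota p`_1 ^+ 2
    * (x * (1 - x) * y * (1 - y))))) -eAB'; ring.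
have p1 : p`_1 = 0.
  apply: odd_root_not_square sq; rewrite /root !hornerE.
  have -> : 1 - (1 - 2%:R * 'X) ^+ 2 = 4%:R%:P * ('X * (1 - 'X)) :> {poly rat}.
    by rewrite polyC_natr; ring.
  by rewrite !mulf_neq0 ?polyC_eq0 ?polyX_eq0 ?subX0.
move: lin; rewrite p1 rmorph0 mul0r add0r -(rmorph0 iota).
move=> /fps_of_poly2_inj p00.
by rewrite pE p1 p00 mul0r addr0.
Qed.

End ClosedForm.

Theorem theorem4p7 :
  (* the terms with r > n or i > k have a vanishing binomial coefficient *)
  (forall n k : nat,
     #|words123 (k + 2) n|%:R =
     \sum_(r < n.+1) \sum_(i < k.+1)
        2%:R ^+ (n - r) * catalan i * (binz i%:Z (r%:Z - i%:Z))%:R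
        * (binz n%:Z r%:Z)%:R * (binz k%:Z i%:Z)%:R :> rat)
  /\
  (let F : {fps {fps rat}} := words123_gf in
   let x : {fps {fps rat}} := fpsX in
   let y : {fps {fps rat}} := fpsC fpsX in
   let closed_form : {fps {fps rat}} :=
     ((1 - x) * (1 - 2%:R * y))^-1
     * catalan_at (x * y * (1 - y) / ((1 - x) * (1 - 2%:R * y) ^+ 2)) in
   let equation (G : {fps {fps rat}}) : Prop :=
     x * (1 - x) * y * (1 - y) * G ^+ 2 - (1 - x) * (1 - 2%:R * y) * G + 1
     = 0 in
   [/\ F = closed_form,
       forall G : {fps {fps rat}}, G = closed_form <-> equation G,
       algebraic_of_degree (@fps_of_poly2 rat) F 2
     & equation F]).
Proof.
split=> [n k|F x y closed_form equation]; first exact: card_words123_sum.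
split.
- exact: words123_gf_closed.
- move=> G; split=> [->|]; [exact: closed_form_eq | exact: equation_uniq].
- exact: words123_gf_degree.
by rewrite /F words123_gf_closed; exact: closed_form_eq.
Qed.
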